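(* Let $C$ be an algebraically closed field of characteristic zero and let $R$ be a complete local noetherian $C$-algebra with maximal ideal $\mathfrak r$ and residue field $C$. Let $V$ be an $R$-module and let $A:V\to V$ be an $R$-linear endomorphism. Denote by $\overline A:\overline V\to\overline V$ the $C$-linear endomorphism obtained by reducing $A$ modulo $\mathfrak r$, where $\overline V=V/\mathfrak rV$. Then there exist $R$-submodules $\{V(\varrho):\varrho\in\mathrm{Sp}_{\overline A}\}$ of $V$ enjoying the following properties: (1) The $R$-module $V$ is the direct sum of $\{V(\varrho):\varrho\in\mathrm{Sp}_{\overline A}\}$. (2) Each $V(\varrho)$ is stable under $A$. (3) If $\overline{V(\varrho)}$ stands for the image of $V(\varrho)$ in $\overline V=V/\mathfrak rV$, then $\overline{V(\varrho)}=\mathbf G(\overline A,\varrho)$. In addition, if $V$ is free, then each $V(\varrho)$ is also free.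
   Context: $\mathrm{Sp}_{\overline A}$ is the set of eigenvalues of the $C$-linear endomorphism $\overline A$, and $\mathbf G(\overline A,\varrho)=\bigcup_n\ker(\overline A-\varrho\,\mathrm{id})^n$ is the generalized eigenspace of $\overline A$ associated to the eigenvalue $\varrho$.
   Formalization: The R-module V is assumed finitely generated; without this the claim fails, e.g. for R = C, V = C[x] and A multiplication by x, where A has no eigenvalues although V is nonzero. *)

(* Defs.v *)
From HB Require Import structures.
From mathcomp Require Import all_boot all_algebra.
From mathcomp Require Import generic_quotient ring_quotient boolp.

Set Implicit Arguments.
Unset Strict Implicit.
Unset Printing Implicit Defensive.

Import GRing.Theory.
Local Open Scope ring_scope.
Local Open Scope quotient_scope.

Section Modules.
Variables (R : nzRingType) (M : lmodType R).

Definition lspan (S : {pred M}) : {pred M} := fun v =>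
  `[< exists2 s : seq (R * M),
        {in s, forall p, p.2 \in S} & v = \sum_(p <- s) p.1 *: p.2 >].

Lemma lspan_submod_closed (S : {pred M}) : submod_closed (lspan S).
Proof.
split; first by apply/asboolP; exists [::]; rewrite ?big_nil.
move=> a _ _ /asboolP [s sS ->] /asboolP [t tS ->]; apply/asboolP.
exists ([seq (a * p.1, p.2) | p <- s] ++ t) => [p|].
  by rewrite mem_cat => /orP[/mapP[q /sS ? ->]|/tS].
by rewrite big_cat big_map scaler_sumr; congr (_ + _); apply: eq_bigr => p _; rewrite scalerA.
Qed.

HB.instance Definition _ (S : {pred M}) :=
  GRing.isSubmodClosed.Build R M (lspan S) (lspan_submod_closed S).

Definition fin_gen (W : {pred M}) : Prop :=
  exists s : seq M, W =i lspan (mem s).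

Definition lin_indep (B : {pred M}) : Prop :=
  forall (s : seq M) (c : M -> R), uniq s -> {subset s <= B} ->
  \sum_(v <- s) c v *: v = 0 -> {in s, forall v, c v = 0}.

Definition is_free (W : {pred M}) : Prop :=
  exists B : {pred M}, lin_indep B /\ W =i lspan B.

(* The index type may be infinite, so sums range over finite sets of indices. *)
Definition direct_sum (I : choiceType) (W : I -> {pred M}) : Prop :=
  (forall v : M, exists (s : seq I) (w : I -> M),
      [/\ uniq s, forall i, w i \in W i & v = \sum_(i <- s) w i]) /\
  (forall (s : seq I) (w : I -> M), uniq s -> (forall i, w i \in W i) ->
      \sum_(i <- s) w i = 0 -> {in s, forall i, w i = 0}).

End Modules.

Section Rings.
Variable R : comNzRingType.

(* Ideals are the submodules of the regular module [R^o]. *)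
Definition noetherian : Prop :=
  forall J : {pred R^o}, submod_closed J -> fin_gen J.

(* Members of [idealr R] are proper ideals. *)
Definition maximal_ideal (m : idealr R) : Prop :=
  forall J : idealr R, {subset m <= J} -> J =i m.

Definition local_ring (r : idealr R) : Prop :=
  maximal_ideal r /\ (forall m : idealr R, maximal_ideal m -> m =i r).

Definition ideal_pow (r : {pred R}) (n : nat) : {pred R^o} :=
  lspan (fun x : R^o =>
    `[< exists2 t : n.-tuple R, {in t, forall y, y \in r}
                              & x = \prod_(y <- t) y >]).

(* The canonical map from [R] to the inverse limit of the [R / r ^ n] is
   injective and surjective; [u] below represents a compatible sequence. *)
Definition adic_complete (r : {pred R}) : Prop :=
  (forall x : R, (forall n, x \in ideal_pow r n) -> x = 0) /\
  (forall u : nat -> R, (forall n, u n.+1 - u n \in ideal_pow r n) ->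
     exists x : R, forall n, x - u n \in ideal_pow r n).

End Rings.

(* The structure map from [C] to [R / r] is an isomorphism. *)
Definition residue_field_is (C : fieldType) (R : comAlgType C) (r : idealr R)
  : Prop := bijective (fun c : C => \pi_({ideal_quot r}) (c%:A : R)).

Section Reduction.
Variables (C : fieldType) (R : comAlgType C) (r : {pred R}) (V : lmodType R).

(* [r V], generated by the products of elements of [r] and of [V]. *)
Definition ideal_smul : {pred V} :=
  lspan (fun x : V => `[< exists2 a : R, a \in r & exists v : V, x = a *: v >]).

HB.instance Definition _ := GRing.SubmodClosed.on ideal_smul.

Definition reduction : Type := Quotient.quot ideal_smul.

HB.instance Definition _ := GRing.Zmodule.on reduction.

Definition red (v : V) : reduction := \pi_(Quotient.quot ideal_smul) v.

Lemma red_eq (v w : V) : (red v = red w) <-> (v - w \in ideal_smul).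
Proof. by rewrite Quotient.idealrBE; split=> /eqP. Qed.

Lemma red_repr (x : reduction) : red (repr (x : Quotient.quot ideal_smul)) = x.
Proof. exact: reprK. Qed.

Lemma redD : {morph red : v w / v + w}.
Proof. by move=> v w; rewrite /red raddfD. Qed.

(* [C] acts through its structure map to [R]. *)
Definition red_scale (c : C) (x : reduction) : reduction :=
  red (c%:A *: repr (x : Quotient.quot ideal_smul)).

Lemma red_scaleE c v : red_scale c (red v) = red (c%:A *: v).
Proof.
by apply/red_eq; rewrite -scalerBr rpredZ //; apply/red_eq; exact: red_repr.
Qed.

Lemma red_scaleA a b x : red_scale a (red_scale b x) = red_scale (a * b) x.
Proof.
by rewrite -[x]red_repr !red_scaleE scalerA -scalerAl mul1r scalerA.
Qed.

Lemma red_scale1 : left_id 1 red_scale.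
Proof. by move=> x; rewrite -[x]red_repr red_scaleE !scale1r. Qed.

Lemma red_scaleDr : right_distributive red_scale +%R.
Proof.
move=> a x y; rewrite -[x]red_repr -[y]red_repr.
by rewrite -redD !red_scaleE scalerDr redD.
Qed.

Lemma red_scaleDl x : {morph red_scale^~ x : a b / a + b}.
Proof.
by move=> a b; rewrite -[x]red_repr !red_scaleE scalerDl scalerDl redD.
Qed.

HB.instance Definition _ := GRing.Zmodule_isLmodule.Build C reduction
  red_scaleA red_scale1 red_scaleDr red_scaleDl.

Variable A : {linear V -> V}.

Definition red_end (x : reduction) : reduction :=
  red (A (repr (x : Quotient.quot ideal_smul))).

Lemma ideal_smul_stable v : v \in ideal_smul -> A v \in ideal_smul.
Proof.
case/asboolP=> s sS ->; rewrite linear_sum big_seq; apply: rpred_sum => p /sS.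
case/asboolP=> a ar [w ->]; rewrite linearZ rpredZ //; apply/asboolP.
exists [:: (1, A (a *: w))] => [q|]; last by rewrite big_seq1 scale1r.
rewrite inE => /eqP-> /=; apply/asboolP.
by exists a => //; exists (A w); rewrite linearZ.
Qed.

Lemma red_endE v : red_end (red v) = red (A v).
Proof.
apply/red_eq; rewrite -linearB; apply: ideal_smul_stable.
by apply/red_eq; exact: red_repr.
Qed.

Lemma red_end_is_linear : linear red_end.
Proof.
move=> c x y; rewrite -[x]red_repr -[y]red_repr red_endE (red_endE (repr _)).
have scaleE d v : d *: red v = red (d%:A *: v) by exact: red_scaleE.
by rewrite scaleE -redD !red_endE linearP redD scaleE.
Qed.

HB.instance Definition _ :=
  GRing.isLinear.Build C reduction reduction *:%R red_end red_end_is_linear.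

End Reduction.

Arguments reduction {C R} r V.
Arguments red {C R} r {V} v.
Arguments red_end {C R} r {V} A x.

Section Spectrum.
Variables (C : fieldType) (U : lmodType C) (f : {linear U -> U}).

Definition spectrum : {pred C} :=
  fun a => `[< exists2 v : U, v != 0 & f v = a *: v >].

Definition gen_eigenspace (a : C) : {pred U} :=
  fun v => `[< exists n, iter n (fun w => f w - a *: w) v = 0 >].

End Spectrum.

(* Main.v *)
Require Import Defs.
From HB Require Import structures.
From mathcomp Require Import all_boot all_algebra.
From mathcomp Require Import generic_quotient ring_quotient boolp ring.

(** The decomposition is cut out by idempotents that are polynomials in [A].

    Choose generators of [V] and a matrix [M] over [R] which describes [A] on
    them.  Over the residue field the characteristic polynomial of the reduced
    matrix splits as the product of the [('X - a) ^+ m a], and the Chinese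
    remainder theorem ([crt_idempotents]) gives polynomials [h a] that are,
    modulo this product, orthogonal idempotents with sum 1, each killed by
    [('X - a) ^+ m a].  Since [R] is a [C]-algebra, the [h a] can be read in
    [R[X]], where they are idempotents only up to an error in [r].

    The errors are removed in [R[X]] filtered by the ideals [poly_filt r M k]
    of polynomials whose value at [M] is also the value of a polynomial with
    coefficients in [r ^ k].  Cayley-Hamilton bounds the degrees of these
    representatives, so that limits can be taken coefficient by coefficient
    ([poly_filt_complete]), and Newton iteration turns the [h a] into
    polynomials [e a] that are idempotent and orthogonal modulo every
    [poly_filt r M k] ([lift_idempotents]).  Polynomials in the intersection
    of the filtration vanish at [M] ([poly_filt_separated]), so the [e a (A)]
    are orthogonal projections of [V] with sum 1 that commute with [A]; this
    is [spectral_idempotents], and [V(a)] is the image of [e a (A)].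

    On the reduction of [V(a)] a power of [Abar - a] vanishes.  A vector of
    the generalized eigenspace of [a] has therefore trivial components at all
    [b != a], by coprimality of powers of ['X - a] and ['X - b]; and when [a]
    is not an eigenvalue of [Abar], the reduction of [V(a)] is zero, whence
    [V(a) = 0] by a Nakayama argument ([idempotent_in_ideal_smul]).

    If [V] is free it has a finite basis, on which a projection is given by an
    idempotent matrix [E] over [R].  A basis of the row space of the reduction
    of [E], lifted to [R] and multiplied by [E], is a basis of the row space of
    [E] ([idempotent_mx_basis]). *)

Set Implicit Arguments.
Unset Strict Implicit.
Unset Printing Implicit Defensive.

Import GRing.Theory.
Local Open Scope ring_scope.

(** * Spans and powers of ideals *)

Section Spans.
Variables (R : comNzRingType) (M : lmodType R).

Lemma mem_lspan (S : {pred M}) v : v \in S -> v \in lspan S.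
Proof.
move=> vS; apply/asboolP; exists [:: (1, v)]; last by rewrite big_seq1 scale1r.
by move=> p; rewrite inE => /eqP->.
Qed.

Lemma lspan_min (S : {pred M}) (W : submodClosed M) :
  {subset S <= W} -> {subset lspan S <= W}.
Proof.
move=> SW _ /asboolP[s sS ->]; rewrite big_seq; apply: rpred_sum => p /sS pS.
by rewrite rpredZ ?SW.
Qed.

End Spans.

Section IdealPowers.
Variable R : comNzRingType.
Implicit Types r : {pred R}.

HB.instance Definition _ r n := GRing.SubmodClosed.on (ideal_pow r n).

Lemma ideal_powMl r n a x : x \in ideal_pow r n -> a * x \in ideal_pow r n.
Proof. by move=> xn; exact: (@rpredZ R R^o (ideal_pow r n) a x xn). Qed.

Lemma mem_ideal_pow_prod r n (t : n.-tuple R) :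
  {in t, forall y, y \in r} -> \prod_(y <- t) y \in ideal_pow r n.
Proof. by move=> tr; apply: (@mem_lspan R R^o); apply/asboolP; exists t. Qed.

Lemma mem_ideal_powX r n x : x \in r -> x ^+ n \in ideal_pow r n.
Proof.
move=> xr; have := @mem_ideal_pow_prod r n [tuple of nseq n x].
by rewrite big_nseq iter_mulr_1; apply=> y /nseqP[->].
Qed.

(** Works with [R] in place of its regular module, so that ring operations
    can be used on the elements of [ideal_pow r n]. *)
Lemma ideal_pow_ind r n (K : R -> Prop) :
    K 0 -> (forall x y, K x -> K y -> K (x + y)) ->
    (forall a (t : n.-tuple R), {in t, forall y, y \in r} ->
       K (a * \prod_(y <- t) y)) ->
  forall x, x \in ideal_pow r n -> K x.
Proof.
move=> K0 KD Kt x /asboolP[s sn ->]; rewrite big_seq.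
by elim/big_ind: _ => // p /sn/asboolP[t tr ->]; exact: Kt.
Qed.

Lemma ideal_powM r m n x y :
  x \in ideal_pow r m -> y \in ideal_pow r n -> x * y \in ideal_pow r (m + n).
Proof.
move=> xm; elim/ideal_pow_ind: y / => [|y z|b w wr].
- by rewrite mulr0 rpred0.
- by rewrite mulrDr; exact: rpredD.
rewrite mulrCA; apply: ideal_powMl.
elim/ideal_pow_ind: x / xm => [|y z|a u ur].
- by rewrite mul0r rpred0.
- by rewrite mulrDl; exact: rpredD.
rewrite -mulrA -big_cat; apply/ideal_powMl.
apply: (@mem_ideal_pow_prod r (m + n) [tuple of u ++ w]) => z.
by rewrite mem_cat => /orP[/ur|/wr].
Qed.

Lemma ideal_pow_sub r m n x :
  x \in ideal_pow r (m + n) -> x \in ideal_pow r n.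
Proof.
elim/ideal_pow_ind: x / => [|x y|a u ur]; [exact: rpred0 | exact: rpredD |].
apply: ideal_powMl; rewrite -(cat_take_drop m u) big_cat /=; apply: ideal_powMl.
have sz : size (drop m u) == n by rewrite size_drop size_tuple addKn.
by apply: (@mem_ideal_pow_prod r n (Tuple sz)) => y /= /mem_drop; exact: ur.
Qed.

Lemma ideal_pow1 (r : idealr R) x : (x \in ideal_pow r 1) = (x \in r).
Proof.
apply/idP/idP=> [|xr]; last by rewrite -[x]expr1 mem_ideal_powX.
elim/ideal_pow_ind: x / => [|x y|a u ur]; [exact: rpred0 | exact: rpredD |].
apply: idealMr; case/tupleP: u ur => y u ur.
by rewrite (tuple0 u) big_seq1; apply: ur; rewrite mem_head.
Qed.

(** The inverse is the limit of the geometric series, whose n-th partial sum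
    is an inverse modulo [r ^ n]. *)
Lemma complete_inv1B (r : {pred R}) : adic_complete r ->
  forall x, x \in r -> exists y, (1 - x) * y = 1.
Proof.
move=> [sep compl] x xr.
have [|y yP] := compl (fun n => \sum_(i < n) x ^+ i).
  by move=> n; rewrite big_ord_recr addrC addKr mem_ideal_powX.
exists y; apply/eqP; rewrite -subr_eq0; apply/eqP/sep => n.
have -> : (1 - x) * y - 1 = (1 - x) * (y - \sum_(i < n) x ^+ i) - x ^+ n.
  have := subrX1 x n; set s := \sum_(i < n) _ => e.
  by rewrite -[x ^+ n](subrK 1) e; ring.
by apply: rpredB; [exact: ideal_powMl (yP n) | exact: mem_ideal_powX].
Qed.

End IdealPowers.

(** Transports the canonical map from [R] to [R / r] along the inverse of the
    isomorphism from [C] to [R / r]; the structure map of [R] is a section of the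
    result, and this is what allows lifting constants from [C] to [R]. *)
Lemma residue_morphism (C : fieldType) (R : comAlgType C) (r : idealr R) :
  residue_field_is r ->
  exists res : {rmorphism R -> C},
    (forall x, (res x == 0) = (x \in r)) /\ (forall c, res c%:A = c).
Proof.
case=> g gK Kg; pose f x := g (\pi_({ideal_quot r})%qT x).
have fK c : f c%:A = c by exact: gK.
have fr x : f x = 0 -> x \in r.
  move=> fx0; have := Kg (\pi_({ideal_quot r})%qT x); rewrite -/(f x) fx0 scale0r.
  by move/eqP; rewrite -Quotient.idealrBE sub0r rpredN.
have fB x y : x - y \in r -> f x = f y.
  by rewrite Quotient.idealrBE /f => /eqP->.
have rf x : x - (f x)%:A \in r.
  by rewrite Quotient.idealrBE; apply/eqP; rewrite -[LHS]Kg.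
have fadd : zmod_morphism f.
  move=> x y; rewrite -[RHS]fK; apply: fB; rewrite scalerBl.
  have -> (a b : R) : x - y - (a - b) = x - a - (y - b) by ring.
  by rewrite rpredB.
have fmul : monoid_morphism f.
  split=> [|x y]; first by rewrite -[RHS]fK scale1r.
  rewrite -[RHS]fK; apply: fB.
  have -> : (f x * f y)%:A = (f x)%:A * (f y)%:A :> R.
    by rewrite -scalerAl mul1r scalerA.
  have -> (a b : R) : x * y - a * b = x * (y - b) + b * (x - a) by ring.
  by rewrite rpredD ?idealMr.
pose A := GRing.isZmodMorphism.Build R C f fadd.
pose B := GRing.isMonoidMorphism.Build R C f fmul.
pose F : {rmorphism R -> C} := HB.pack f A B.
exists F; split=> // x; apply/eqP/idP => [/fr//|xr].
by rewrite -(raddf0 F); apply: fB; rewrite subr0.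
Qed.

(** * Matrices over a complete ring with residue map *)

Section LocalMatrices.
Variables (C : fieldType) (R : comAlgType C) (r : idealr R).
Variable res : {rmorphism R -> C}.
Hypotheses (complR : adic_complete r) (kerE : forall x, (res x == 0) = (x \in r))
           (resK : forall c, res c%:A = c).

Lemma residue1_unit x : res x = 1 -> exists y, x * y = 1.
Proof.
move=> x1; have [|y] := complete_inv1B complR (x := 1 - x).
  by rewrite -kerE rmorphB rmorph1 x1 subrr.
by rewrite subKr => xy; exists y.
Qed.

(** The determinant is congruent to 1, hence invertible, and the adjugate does
    the rest. *)
Lemma residue1_unitmx n (M : 'M[R]_n) :
  map_mx res M = 1%:M -> exists U, M *m U = 1%:M /\ U *m M = 1%:M.
Proof.
move=> M1; have [|y dy] := residue1_unit (x := \det M).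
  by rewrite -det_map_mx M1 det1.
exists (y *: \adj M).
by rewrite -scalemxAr -scalemxAl mul_mx_adj mul_adj_mx scale_scalar_mx mulrC dy.
Qed.

(** The image of an idempotent matrix is free.  Let [B] be a basis of the row
    space of the reduced matrix [E0] and let [T] be the product of a lift of
    [B] with [E].  The rows of [T] are independent because [T] times a lift of
    a right inverse of [B] reduces to the identity.  They span the image of
    [E] because [E0 = X0 *m B] lifts to a congruence [E = X *m T + N], with [N]
    reducing to 0, and [N *m E = N], so [(1 - N) *m E = X *m T]. *)
Lemma idempotent_mx_basis m (E : 'M[R]_m) : E *m E = E ->
  exists k (T : 'M[R]_(k, m)), [/\ T *m E = T, exists Y, E = Y *m T
                                & forall y : 'rV_k, y *m T = 0 -> y = 0].
Proof.
move=> EE; pose E0 := map_mx res E.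
have E0E0 : E0 *m E0 = E0 by rewrite -map_mxM EE.
pose lift a b (N : 'M[C]_(a, b)) := map_mx (in_alg R) N.
have liftK a b (N : 'M[C]_(a, b)) : map_mx res (lift a b N) = N.
  by apply/matrixP=> i j; rewrite !mxE; exact: resK.
pose B := row_base E0; pose T := lift _ _ B *m E.
have BE : B *m E0 = B.
  have /submxP[D ->] : (B <= E0)%MS by rewrite eq_row_base.
  by rewrite -mulmxA E0E0.
have resT : map_mx res T = B by rewrite map_mxM liftK BE.
have TE : T *m E = T by rewrite -mulmxA EE.
exists (\rank E0), T; split=> // [|y yT].
  pose X := lift _ _ (col_base E0); pose N := E - X *m T.
  have [|U [_ UN]] := residue1_unitmx (M := 1%:M - N).
    rewrite !map_mxB map_mx1 map_mxM resT liftK mulmx_base -/E0.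
    by rewrite subrr subr0.
  exists (U *m X).
  have NE : (1%:M - N) *m E = X *m T.
    by rewrite /N mulmxBl mul1mx mulmxBl EE -mulmxA TE subKr.
  by rewrite -mulmxA -NE mulmxA UN mul1mx.
pose P := lift _ _ (pinvmx B).
have [|U [TU _]] := residue1_unitmx (M := T *m P).
  by rewrite map_mxM resT liftK mulmxVp ?row_base_free.
by rewrite -[y]mulmx1 -TU -(mulmxA T) (mulmxA y) yT mul0mx.
Qed.

End LocalMatrices.

(** * Lifting idempotents *)

(** A decreasing chain of ideals for which [S] is complete, though perhaps not
    separated: the intersection of the [J k] stands for the zero ideal of the
    separated quotient.  The [J k] are plain predicates because [J 0] is
    usually all of [S], whereas [idealr] describes proper ideals. *)
Record complete_filtration (S : comNzRingType) (J : nat -> S -> Prop) : Prop := {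
  filt0 : forall k, J k 0;
  filtD : forall k x y, J k x -> J k y -> J k (x + y);
  filtMl : forall k a x, J k x -> J k (a * x);
  filtM : forall k x y, J k.+1 x -> J k.+1 y -> J k.+2 (x * y);
  filtW : forall k x, J k.+1 x -> J k x;
  filt_lim : forall u : nat -> S, (forall k, J k (u k.+1 - u k)) ->
    exists x, forall k, J k (x - u k) }.

Section Lifting.
Variables (S : comNzRingType) (J : nat -> S -> Prop).
Hypothesis filtJ : complete_filtration J.

Let JN k x : J k x -> J k (- x).
Proof. by rewrite -mulN1r; exact: filtMl. Qed.

Let JB k x y : J k x -> J k y -> J k (x - y).
Proof. by move=> Jx /JN; exact: filtD. Qed.

Let J_sum k (I : eqType) (s : seq I) (P : pred I) (F : I -> S) :
  (forall i, i \in s -> P i -> J k (F i)) -> J k (\sum_(i <- s | P i) F i).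
Proof.
rewrite big_seq_cond => JF; elim/big_ind: _ => [|x y|i /andP[si Pi]].
- exact: filt0.
- exact: filtD.
- exact: JF.
Qed.

(** Since [g] agrees with its square, membership in [J k] improves to
    membership in [J k.+1]. *)
Lemma idempotent_filt1 g :
  J 1 g -> (forall k, J k (g * g - g)) -> forall k, J k g.
Proof.
move=> g1 gg; case=> [|k]; first exact: filtW.
elim: k => // k IH; rewrite (_ : g = g * g - (g * g - g)); last by ring.
by apply: JB => //; exact: filtM.
Qed.

(** Newton iteration for the equation [e * e = e]: the step
    [e |-> 3 e ^ 2 - 2 e ^ 3] changes [e] by a multiple of the defect
    [e * e - e] and makes the new defect a multiple of the square of the old
    one. *)
Lemma lift_idempotent h : J 1 (h * h - h) ->
  exists2 e, J 1 (e - h) & forall k, J k (e * e - e).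
Proof.
move=> h1; pose F e : S := (e * e *+ 3) - (e * e * e *+ 2).
pose u k := iter k F h.
have uu k : J k.+1 (u k * u k - u k).
  elim: k => // k IH; rewrite /= -/(u k).
  have -> : F (u k) * F (u k) - F (u k) =
     (4%:R * u k * u k - 4%:R * u k - 3%:R)
      * ((u k * u k - u k) * (u k * u k - u k)) by rewrite /F; ring.
  by apply: filtMl => //; exact: filtM.
have uS k : J k.+1 (u k.+1 - u k).
  have -> : u k.+1 - u k = (1 - 2%:R * u k) * (u k * u k - u k).
    by rewrite /= -/(u k) /F; ring.
  exact: filtMl.
have [k|e eu] := filt_lim filtJ (u := u); first exact: filtW.
exists e => [|k].
  by rewrite -(subrKA (u 1%N)); apply: filtD => //; exact: (uS 0%N).
have -> : e * e - e = (u k * u k - u k) + (e + u k - 1) * (e - u k) by ring.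
by apply: filtD => //; [exact: filtW | exact: filtMl].
Qed.

(** The idempotents can be lifted one by one: the products [e i * e j] and the
    difference [1 - \sum_i e i] are then idempotents, modulo every [J k], that
    lie in [J 1], so they lie in every [J k] by [idempotent_filt1]. *)
Lemma lift_idempotents (I : eqType) (s : seq I) (h : I -> S) : uniq s ->
    {in s, forall i, J 1 (h i * h i - h i)} ->
    {in s &, forall i j, i != j -> J 1 (h i * h j)} ->
    J 1 (\sum_(i <- s) h i - 1) ->
  exists e : I -> S,
    [/\ {in s, forall i, J 1 (e i - h i)},
        {in s, forall i k, J k (e i * e i - e i)},
        {in s &, forall i j, i != j -> forall k, J k (e i * e j)}
      & forall k, J k (\sum_(i <- s) e i - 1)].
Proof.
move=> us hh hO h1.
have /choice[e eP] i : exists e, i \in s ->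
    J 1 (e - h i) /\ forall k, J k (e * e - e).
  have [/hh/lift_idempotent[e e1 ee]|] := boolP (i \in s); last by exists 0.
  by exists e.
have eh i : i \in s -> J 1 (e i - h i) by case/eP.
have ee i : i \in s -> forall k, J k (e i * e i - e i) by case/eP.
have eO : {in s &, forall i j, i != j -> forall k, J k (e i * e j)}.
  move=> i j si sj ij; apply: idempotent_filt1 => [|k].
    have -> : e i * e j = h i * h j + h i * (e j - h j) + e j * (e i - h i) by ring.
    by do 2?[apply: filtD => //]; [exact: hO | | ]; apply: filtMl => //; exact: eh.
  have -> : e i * e j * (e i * e j) - e i * e j =
    e j * e j * (e i * e i - e i) + e i * (e j * e j - e j) by ring.
  by apply: filtD => //; apply: filtMl => //; exact: ee.
exists e; split=> //; set q := \sum_(i <- s) e i.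
have q1 : J 1 (1 - q).
  rewrite -opprB; apply: JN.
  have -> : q - 1 = \sum_(i <- s) (e i - h i) + (\sum_(i <- s) h i - 1).
    by rewrite sumrB addrA subrK.
  by apply: filtD => //; apply: J_sum => i /eh.
have qq k : J k ((1 - q) * (1 - q) - (1 - q)).
  rewrite (_ : _ - _ = q * q - q); last by ring.
  rewrite {2 3}/q mulr_sumr -sumrB; apply: J_sum => i si _.
  rewrite mulrC mulr_sumr (bigD1_seq i) //= addrAC; apply: filtD; first exact: filtJ.
    exact: ee.
  by apply: J_sum => j sj ji; apply: eO => //; rewrite eq_sym.
by move=> k; rewrite -opprB; apply/JN/idempotent_filt1.
Qed.

End Lifting.

(** * Idempotents modulo a split polynomial *)

Lemma dvdp_prod_coprime (F : fieldType) (I : eqType) (s : seq I)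
    (L : I -> {poly F}) q : uniq s ->
  (forall i j, i != j -> coprimep (L i) (L j)) ->
  {in s, forall i, L i %| q} -> \prod_(i <- s) L i %| q.
Proof.
move=> + co; elim: s => [|i s IH] /= => [_ _|/andP[is_ us] Lq].
  by rewrite big_nil dvd1p.
rewrite big_cons Gauss_dvdp.
  by rewrite Lq ?mem_head // IH // => j js; rewrite Lq // inE js orbT.
rewrite big_seq; elim/big_ind: _ => [|x y cx cy|j js]; first exact: coprimep1.
  by rewrite coprimepMr cx.
by apply: co; apply: contraNneq is_ => ->.
Qed.

(** Write [p] as the product of the [L a := ('X - a) ^+ m a] and let [Q a] be
    the product of the [L b] for [b != a].  A Bezout relation
    [u * L a + w * Q a = 1] gives [h a := w * Q a], which is 1 modulo [L a] and 0
    modulo the other [L b].  For [a] that is not a root, [m a = 0] and [h a] is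
    a multiple of [p]. *)
Lemma crt_idempotents (C : closedFieldType) (p : {poly C}) : p \is monic ->
  exists (s : seq C) (m : C -> nat) (h : C -> {poly C}),
    [/\ uniq s,
        forall a, p %| h a * h a - h a,
        forall a b, a != b -> p %| h a * h b,
        p %| \sum_(a <- s) h a - 1
      & forall a, p %| ('X - a%:P) ^+ m a * h a].
Proof.
move=> /monicP p1; have [t] := closed_field_poly_normal p.
rewrite p1 scale1r -prodr_undup_exp_count => pE.
pose s := undup t; have us : uniq s by exact: undup_uniq.
pose m a := count_mem a t; pose L a : {poly C} := ('X - a%:P) ^+ m a.
pose Q a := \prod_(b <- s | b != a) L b.
have pLQ a : p = L a * Q a.
  have [sa|sa] := boolP (a \in s); first by rewrite pE (bigD1_seq a).
  have -> : L a = 1.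
    by rewrite /L (_ : m a = 0%N) //; apply/count_memPn; rewrite -mem_undup.
  rewrite mul1r pE big_seq [RHS]big_seq_cond; apply: eq_bigl => b.
  by case: eqVneq => [->|]; rewrite ?andbT // (negPf sa).
have co a b : a != b -> coprimep (L a) (L b).
  move=> ab; apply/coprimep_expl/coprimep_expr; rewrite coprimep_XsubC root_XsubC.
  by rewrite eq_sym.
have coQ a : coprimep (L a) (Q a).
  rewrite /Q; elim/big_ind: _ => [|x y cx cy|b ba]; first exact: coprimep1.
    by rewrite coprimepMr cx.
  by apply: co; rewrite eq_sym.
have /choice[w wP] a : exists w, w.1 * L a + w.2 * Q a = 1.
  exact/Bezout_eq1_coprimepP.
have LQ a b : a \in s -> a != b -> L a %| Q b.
  by move=> sa ab; rewrite /Q (big_rem a) //= ab dvdp_mulr.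
pose h a := (w a).2 * Q a.
have hE a : h a = 1 - (w a).1 * L a by rewrite /h -(wP a); ring.
have dh a b : L a %| h b -> p %| h a * h b.
  by move=> d; rewrite (pLQ a) mulrC dvdp_mul // dvdp_mull.
exists s, m, h; split=> // [a|a b ab||a].
- have -> : h a * h a - h a = - (w a).1 * (w a).2 * (L a * Q a).
    by rewrite -[X in _ - X]mulr1 -mulrBr {2}hE /h; ring.
  by rewrite -pLQ dvdp_mull.
- have [sa|sa] := boolP (a \in s); first by apply: dh; rewrite dvdp_mull ?LQ.
  have [sb|sb] := boolP (b \in s).
    by rewrite mulrC; apply: dh; rewrite dvdp_mull ?LQ // eq_sym.
  apply: dh; rewrite (_ : L a = 1) ?dvd1p //.
  by rewrite /L (_ : m a = 0%N) //; apply/count_memPn; rewrite -mem_undup.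
- rewrite {1}pE; apply: dvdp_prod_coprime => // a sa.
  rewrite (bigD1_seq a) //= addrAC dvdp_add //.
    by rewrite hE addrAC subrr sub0r dvdpNr dvdp_mull.
  elim/big_ind: _ => [|x y|b ba]; [exact: dvdp0 | exact: dvdp_add | ].
  by rewrite dvdp_mull ?LQ // eq_sym.
by rewrite -/(L a) {1}(pLQ a) dvdp_mul // dvdp_mull.
Qed.

(** * The filtration of R[X] attached to a matrix *)

Section PolynomialFiltration.
Variables (C : fieldType) (R : comAlgType C) (r : idealr R).
Variable res : {rmorphism R -> C}.
Hypotheses (complR : adic_complete r) (kerE : forall x, (res x == 0) = (x \in r))
           (resK : forall c, res c%:A = c).
Variables (n : nat) (M : 'M[R]_n.+1).

(** The inverse image, under evaluation at [M], of the image of the polynomials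
    with coefficients in [r ^ k]: the [r]-adic filtration of the subalgebra
    generated by [M], pulled back to [R[X]]. *)
Definition poly_filt (k : nat) (p : {poly R}) : Prop :=
  exists2 s : {poly R}, forall i, s`_i \in ideal_pow r k
                      & horner_mx M p = horner_mx M s.

(** By Cayley-Hamilton, division by the characteristic polynomial does not
    change the value at [M]; and the remainder of [s] is a combination of the
    remainders of the powers of ['X] with the coefficients of [s]. *)
Lemma reduce_mod_char_poly k (s : {poly R}) :
  (forall i, s`_i \in ideal_pow r k) ->
  exists s' : {poly R}, [/\ (size s' <= n.+1)%N,
    forall i, s'`_i \in ideal_pow r k & horner_mx M s' = horner_mx M s].
Proof.
move=> sk; have mon := char_poly_monic M.
exists (Pdiv.Ring.rmodp s (char_poly M)); split=> [|i|].
- by rewrite -ltnS -(size_char_poly M) Pdiv.Ring.ltn_rmodp monic_neq0.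
- rewrite -[s]coefK poly_def Pdiv.RingMonic.rmodp_sum // coef_sum.
  apply: rpred_sum => j _; rewrite Pdiv.RingMonic.rmodpZ // coefZ mulrC.
  exact: ideal_powMl.
rewrite [in RHS](Pdiv.RingMonic.rdivp_eq mon s) rmorphD rmorphM /=.
by rewrite Cayley_Hamilton mulr0 add0r.
Qed.

(** The successive differences of a Cauchy sequence are represented by
    polynomials of bounded size with coefficients in [r ^ k]; the partial
    sums of these converge coefficientwise because [R] is complete. *)
Lemma poly_filt_complete : complete_filtration poly_filt.
Proof.
split=> [k|k x y [s sk xs] [t tk yt]|k a x [s sk xs]|k x y [s sk xs] [t tk yt]
        |k x [s sk xs]|u uk].
- by exists 0 => // i; rewrite coef0 rpred0.
- by exists (s + t); rewrite ?rmorphD /= ?xs ?yt // => i; rewrite coefD; exact: rpredD.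
- exists (a * s); rewrite ?rmorphM /= ?xs // => i; rewrite coefM.
  by apply: rpred_sum => j _; exact: ideal_powMl.
- exists (s * t); rewrite ?rmorphM /= ?xs ?yt // => i; rewrite coefM.
  apply: rpred_sum => j _; apply: (@ideal_pow_sub _ _ k).
  by rewrite addnS -addSn; exact: ideal_powM.
- by exists s => // i; exact: (@ideal_pow_sub _ _ 1).
have /choice[s sP] k : exists s : {poly R}, [/\ (size s <= n.+1)%N,
    forall i, s`_i \in ideal_pow r k & horner_mx M (u k.+1 - u k) = horner_mx M s].
  have [s0 s0k ->] := uk k; have [s [? ? <-]] := reduce_mod_char_poly s0k.
  by exists s.
pose t k := \sum_(j < k) s j.
have ut k : horner_mx M (u k - u 0%N) = horner_mx M (t k).
  elim: k => [|k IH]; first by rewrite /t big_ord0 subrr.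
  rewrite /t big_ord_recr /= -/(t k) [in RHS]rmorphD /= -IH; case: (sP k) => _ _ <-.
  by rewrite -rmorphD; congr horner_mx; ring.
have /choice[x xP] i : exists y, forall k, y - (t k)`_i \in ideal_pow r k.
  apply: complR.2 => k; rewrite /t big_ord_recr coefD addrC addKr.
  by case: (sP k).
pose X := \poly_(i < n.+1) x i.
exists (u 0%N + X) => k; exists (X - t k) => [i|]; last first.
  by rewrite [in RHS]rmorphB /= -ut -rmorphB; congr horner_mx; ring.
rewrite coefB coef_poly; case: ltnP => // ni.
rewrite [(t k)`_i](_ : _ = 0) ?subrr ?rpred0 // /t coef_sum big1 // => j _.
by rewrite nth_default //; case: (sP j) => sj _ _; exact: leq_trans ni.
Qed.

Lemma horner_mx_sum (p : {poly R}) :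
  horner_mx M p = \sum_(i < size p) p`_i *: M ^+ i.
Proof.
rewrite -{1}[p]coefK poly_def rmorph_sum; apply: eq_bigr => i _.
by rewrite /= horner_mxZ rmorphXn /= horner_mx_X.
Qed.

Lemma poly_filt_separated p :
  (forall k, poly_filt k p) -> horner_mx M p = 0.
Proof.
move=> pk; apply/matrixP=> i j; rewrite [RHS]mxE; apply: complR.1 => k.
have [s sk ->] := pk k; rewrite horner_mx_sum summxE.
by apply: rpred_sum => l _; rewrite mxE mulrC; exact: ideal_powMl.
Qed.

(** If the reduced [p] is [q] times the reduced characteristic polynomial,
    subtracting from [p] the multiple of the characteristic polynomial by a
    lift of [q] leaves the value at [M] unchanged and a polynomial with
    coefficients in [r]. *)
Lemma poly_filt1_of_residue p :
  char_poly (map_mx res M) %| map_poly res p -> poly_filt 1 p.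
Proof.
case/dvdpP=> q pq; pose lq := map_poly (in_alg R) q.
exists (p - lq * char_poly M) => [i|]; last first.
  by rewrite rmorphB rmorphM /= Cayley_Hamilton mulr0 subr0.
rewrite ideal_pow1 -kerE -coef_map rmorphB rmorphM /= map_char_poly pq.
rewrite -map_poly_comp (_ : map_poly _ q = q) ?subrr ?coef0 //.
by apply: map_poly_id => c _; exact: resK.
Qed.

End PolynomialFiltration.

(** * V as a module over R[X] *)

Section PolynomialAction.
Variables (R : comNzRingType) (V : lmodType R) (A : {linear V -> V}).
Implicit Types (p q : {poly R}) (v : V).

Definition poly_act p v : V := \sum_(i < size p) p`_i *: iter i A v.

Lemma poly_act_widen n p v : (size p <= n)%N ->
  poly_act p v = \sum_(i < n) p`_i *: iter i A v.
Proof.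
move=> pn; rewrite /poly_act (big_ord_widen n (fun i => p`_i *: iter i A v)) //.
rewrite big_mkcond; apply: eq_bigr => i _.
by case: ltnP => // /(nth_default 0) ->; rewrite scale0r.
Qed.

Lemma poly_act_is_linear p : linear (poly_act p).
Proof.
move=> a v w; rewrite /poly_act scaler_sumr -big_split; apply: eq_bigr => i _ /=.
rewrite scalerA mulrC -scalerA -scalerDr; congr (_ *: _).
by elim: (val i) => //= k ->; rewrite linearP.
Qed.

HB.instance Definition _ p :=
  GRing.isLinear.Build R V V *:%R (poly_act p) (poly_act_is_linear p).

Lemma poly_actD p q v : poly_act (p + q) v = poly_act p v + poly_act q v.
Proof.
pose n := maxn (size p) (size q).
rewrite !(@poly_act_widen n) ?leq_maxl ?leq_maxr ?size_polyD // -big_split.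
by apply: eq_bigr => i _; rewrite coefD scalerDl.
Qed.

Lemma poly_actC c v : poly_act c%:P v = c *: v.
Proof. by rewrite (@poly_act_widen 1) ?size_polyC_leq1 // big_ord1 coefC. Qed.

Lemma poly_act0 v : poly_act 0 v = 0.
Proof. by rewrite /poly_act size_poly0 big_ord0. Qed.

Lemma poly_act1 v : poly_act 1 v = v.
Proof. by rewrite -polyC1 poly_actC scale1r. Qed.

Lemma poly_actMX p v : poly_act (p * 'X) v = A (poly_act p v).
Proof.
rewrite (@poly_act_widen (size p).+1); last first.
  by rewrite (leq_trans (size_polyMleq _ _)) // size_polyX addn2.
rewrite big_ord_recl coefMX scale0r add0r linear_sum; apply: eq_bigr => i _.
by rewrite coefMX linearZ.
Qed.

Lemma poly_actM p q v : poly_act (p * q) v = poly_act p (poly_act q v).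
Proof.
elim/poly_ind: p => [|p c IH]; first by rewrite mul0r !poly_act0.
rewrite mulrDl mulrAC !poly_actD !poly_actMX IH; congr (_ + _).
rewrite poly_actC; elim/poly_ind: q {IH} => [|q d IH].
  by rewrite mulr0 !poly_act0 scaler0.
rewrite mulrDr mulrA -polyCM !poly_actD !poly_actMX !poly_actC IH.
by rewrite linearZ scalerDr scalerA.
Qed.

Lemma poly_act_sum (I : Type) (s : seq I) (P : pred I) (F : I -> {poly R}) v :
  poly_act (\sum_(i <- s | P i) F i) v = \sum_(i <- s | P i) poly_act (F i) v.
Proof.
apply: (big_morph (poly_act^~ v)) => [p q|]; first exact: poly_actD.
exact: poly_act0.
Qed.

End PolynomialAction.

(** * Finite families of vectors *)

Section Combinations.
Variables (R : comNzRingType) (V : lmodType R).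

Definition comb n (t : 'I_n -> V) (x : 'rV[R]_n) : V := \sum_i x 0 i *: t i.

Lemma comb_is_linear n (t : 'I_n -> V) : linear (comb t).
Proof.
move=> a x y; rewrite /comb scaler_sumr -big_split; apply: eq_bigr => i _.
by rewrite !mxE scalerDl scalerA.
Qed.

HB.instance Definition _ n (t : 'I_n -> V) :=
  GRing.isLinear.Build R 'rV[R]_n V *:%R (comb t) (comb_is_linear t).

Lemma comb_delta n (t : 'I_n -> V) i : comb t (delta_mx 0 i) = t i.
Proof.
rewrite /comb (bigD1 i) //= big1 => [|j ji]; first by rewrite mxE !eqxx scale1r addr0.
by rewrite mxE (negPf ji) andbF scale0r.
Qed.

Lemma comb_mulmx m n (t : 'I_n -> V) (x : 'rV_m) (N : 'M_(m, n)) :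
  comb t (x *m N) = comb (fun i => comb t (row i N)) x.
Proof.
rewrite mulmx_sum_row linear_sum; apply: eq_bigr => i _.
by rewrite linearZ.
Qed.

Lemma lspan_comb (b : seq V) v : v \in lspan (mem b) ->
  exists x, v = comb (fun i : 'I_(size b) => b`_i) x.
Proof.
case/asboolP=> s sb ->; rewrite big_seq.
elim/big_ind: _ => [|_ _ [x ->] [y ->]|p /sb pb]; first by exists 0; rewrite linear0.
  by exists (x + y); rewrite linearD.
have lt : (index p.2 b < size b)%N by rewrite index_mem.
exists (p.1 *: delta_mx 0 (Ordinal lt)).
by rewrite linearZ /= comb_delta nth_index.
Qed.

Lemma comb_lspan n (t : 'I_n -> V) x : comb t x \in lspan (mem (codom t)).
Proof.
by apply: rpred_sum => i _; apply: rpredZ; apply: mem_lspan; exact: codom_f.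
Qed.

(** An independent family is injective, so that combinations of a duplicate-free
    list of its values are combinations of the family itself. *)
Lemma lin_indep_codom n (t : 'I_n -> V) :
  (forall x, comb t x = 0 -> x = 0) -> lin_indep (mem (codom t)).
Proof.
move=> t0 s c us sub cs.
have tinj : injective t.
  move=> i j tij; apply/eqP; have /t0/rowP/(_ i) : comb t (delta_mx 0 i - delta_mx 0 j) = 0.
    by rewrite linearB /= !comb_delta tij subrr.
  rewrite !mxE !eqxx /=; case: (i == j) => //.
  by move/eqP; rewrite subr0 oner_eq0.
have ps : perm_eq s [seq t i | i <- enum 'I_n & t i \in s].
  apply: uniq_perm => //; first by rewrite map_inj_uniq // filter_uniq ?enum_uniq.
  move=> v; apply/idP/mapP => [sv|[i]]; last by rewrite mem_filter => /andP[? _] ->.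
  have /codomP[i vi] := sub _ sv; exists i => //.
  by rewrite mem_filter mem_enum -vi sv.
pose x : 'rV[R]_n := \row_i (if t i \in s then c (t i) else 0).
have /t0/rowP x0 : comb t x = 0.
  rewrite -[RHS]cs (perm_big _ ps) big_map big_filter /= big_enum_cond big_mkcond.
  by apply: eq_bigr => i _; rewrite mxE; case: ifP => //; rewrite scale0r.
move=> v sv; have /codomP[i vi] := sub _ sv.
by have := x0 i; rewrite !mxE -vi sv.
Qed.

(** The added zero vector makes the number of generators positive, as needed for
    square matrices to form a nontrivial ring, where polynomials can be
    evaluated. *)
Lemma finite_generators : fin_gen (predT : {pred V}) ->
  exists n (t : 'I_n.+1 -> V), forall v, exists x, v = comb t x.
Proof.
case=> s sP; exists (size s), (fun i => (0 :: s)`_i) => v.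
apply: (@lspan_comb (0 :: s)).
have : v \in lspan (mem s) by rewrite -sP.
apply: lspan_min v => w ws; apply: mem_lspan.
by rewrite -[_ \in _]/(w \in 0 :: s) inE (ws : w \in s) orbT.
Qed.

(** Finitely many elements of a basis are enough to express a finite set of
    generators, and hence all of [V]. *)
Lemma free_finite_basis :
  fin_gen (predT : {pred V}) -> is_free (predT : {pred V}) ->
  exists m (t : 'I_m -> V), (forall v, exists x, v = comb t x)
     /\ (forall x, comb t x = 0 -> x = 0).
Proof.
move=> [g gP] [B [Bi BP]].
have /choice[f fP] v : exists b : seq V, {subset b <= B} /\ v \in lspan (mem b).
  have : v \in lspan B by rewrite -BP.
  case/asboolP=> s sB ->; exists [seq p.2 | p <- s]; split.
    by move=> _ /mapP[p /sB ? ->].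
  rewrite big_seq; apply: rpred_sum => p ps; apply/rpredZ/mem_lspan.
  exact: map_f.
pose b := undup (flatten [seq f v | v <- g]).
have bB : {subset b <= B}.
  move=> v; rewrite mem_undup => /flatten_mapP[w _]; exact: (fP w).1.
exists (size b), (fun i => b`_i); split=> [v|x x0].
  apply: lspan_comb; have : v \in lspan (mem g) by rewrite -gP.
  apply: lspan_min v => v vg; apply: lspan_min (fP v).2 => w wv.
  apply: mem_lspan; rewrite -[_ \in _]/(w \in b) mem_undup.
  by apply/flatten_mapP; exists v.
pose c v := \sum_(i < size b | b`_i == v) x 0 i.
have cE (i : 'I_(size b)) : c b`_i = x 0 i.
  rewrite /c (big_pred1 i) // => j.
  by rewrite nth_uniq ?undup_uniq // (inj_eq val_inj).
have c0 : {in b, forall v, c v = 0}.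
  apply: Bi => //; first exact: undup_uniq.
  rewrite (big_nth 0) big_mkord -[RHS]x0; apply: eq_bigr => i _.
  by rewrite cE.
by apply/rowP=> i; rewrite mxE -cE c0 ?mem_nth.
Qed.

End Combinations.

(** * Endomorphisms and reduction *)

Arguments ideal_smul {C R} r {V}.

Section FixedPoints.
Variables (R : comNzRingType) (V : lmodType R) (f : {linear V -> V}).

Definition fixed : {pred V} := fun v => f v == v.

Lemma fixedP v : reflect (f v = v) (v \in fixed).
Proof. exact: eqP. Qed.

Lemma fixed_submod_closed : submod_closed fixed.
Proof.
split=> [|a v w /fixedP fv /fixedP fw]; first by apply/fixedP; rewrite linear0.
by apply/fixedP; rewrite linearP fv fw.
Qed.

HB.instance Definition _ :=
  GRing.isSubmodClosed.Build R V fixed fixed_submod_closed.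

End FixedPoints.

Section Endomorphisms.
Variables (R : comNzRingType) (V : lmodType R).

(** The property [P] of the rows lets the matrix inherit constraints on the
    images of the generators, such as having coefficients in an ideal. *)
Lemma end_matrix n (t : 'I_n -> V) (f : {linear V -> V}) (P : 'rV[R]_n -> Prop) :
    (forall i, exists2 x, P x & f (t i) = comb t x) ->
  exists2 N : 'M_n, forall i, P (row i N) & forall x, f (comb t x) = comb t (x *m N).
Proof.
move=> tP; have /choice[N NP] i : exists x, P x /\ f (t i) = comb t x.
  by case: (tP i) => x; exists x.
exists (\matrix_i N i) => [i|x]; first by rewrite rowK; case: (NP i).
rewrite comb_mulmx linear_sum; apply: eq_bigr => i _.
by rewrite linearZ rowK /=; case: (NP i) => _ ->.
Qed.

Lemma poly_act_comb n (t : 'I_n.+1 -> V) (A : {linear V -> V}) (M : 'M_n.+1) :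
    (forall x, A (comb t x) = comb t (x *m M)) ->
  forall p x, poly_act A p (comb t x) = comb t (x *m horner_mx M p).
Proof.
move=> AM; elim/poly_ind => [|p c IH] x.
  by rewrite poly_act0 rmorph0 mulmx0 linear0.
rewrite poly_actD poly_actMX poly_actC IH AM rmorphD rmorphM /= horner_mx_X horner_mx_C.
by rewrite mulmxDr mulmxA linearD mul_mx_scalar linearZ.
Qed.

End Endomorphisms.

Section Reductions.
Variables (C : fieldType) (R : comAlgType C) (r : idealr R) (V : lmodType R).

Lemma redB (v w : V) : red r (v - w) = red r v - red r w.
Proof. by rewrite /red raddfB. Qed.

Lemma red_eq0 (v : V) : (red r v = 0) <-> (v \in ideal_smul r).
Proof.
have <- : red r (0 : V) = 0 by rewrite /red raddf0.
by rewrite red_eq subr0.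
Qed.

Lemma red_scalar (c : C) (v : V) : c *: red r v = red r (c%:A *: v).
Proof. exact: red_scaleE. Qed.

Lemma iter_red_end (A : {linear V -> V}) (a : C) m v :
  iter m (fun w => red_end r A w - a *: w) (red r v)
  = red r (poly_act A (('X - a%:A%:P) ^+ m) v).
Proof.
elim: m => [|m IH]; first by rewrite expr0 poly_act1.
rewrite iterS IH red_endE red_scalar -redB exprS poly_actM; congr red.
set w := poly_act _ _ v.
by rewrite -polyCN -['X]mul1r poly_actD poly_actMX poly_act1 poly_actC scaleNr.
Qed.

Lemma ideal_smul_comb n (t : 'I_n -> V) : (forall v, exists x, v = comb t x) ->
  forall v, v \in ideal_smul r ->
  exists2 x : 'rV_n, forall i, x 0 i \in r & v = comb t x.
Proof.
move=> tgen v /asboolP[s sP ->]; rewrite big_seq.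
elim/big_ind: _ => [|_ _ [x xr ->] [y yr ->]|p /sP/asboolP[a ar [w ->]]].
- by exists 0 => [i|]; rewrite ?linear0 // mxE rpred0.
- by exists (x + y) => [i|]; rewrite ?linearD // mxE rpredD.
have combZ b y : comb t (b *: y) = b *: comb t y by exact: linearZ.
have [x ->] := tgen w; exists (p.1 *: (a *: x)) => [i|]; last by rewrite !combZ.
by rewrite !mxE mulrCA mulrC !idealMr // mulrC idealMr.
Qed.

End Reductions.

Lemma gen_eigenspace_not_spectrum (C : fieldType) (U : lmodType C)
    (f : {linear U -> U}) (a : C) x :
  a \notin spectrum f -> x \in gen_eigenspace f a -> x = 0.
Proof.
move=> na /asboolP[n]; elim: n => //= n IH; set y := iter n _ x => fy.
apply: IH; apply: contraNeq na => y0; apply/asboolP; exists y => //.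
by apply/eqP; rewrite -subr_eq0; apply/eqP.
Qed.

Section Complete.
Variables (C : fieldType) (R : comAlgType C) (r : idealr R).
Variable res : {rmorphism R -> C}.
Hypotheses (complR : adic_complete r) (kerE : forall x, (res x == 0) = (x \in r))
           (resK : forall c, res c%:A = c).
Variable V : lmodType R.
Hypothesis fgV : fin_gen (predT : {pred V}).

(** A form of Nakayama's lemma.  On generators [f] is given by a matrix [N] with
    coefficients in [r], so [1 - N] is invertible and every vector has the
    form [w - f w]; but [f] kills such vectors. *)
Lemma idempotent_in_ideal_smul (f : {linear V -> V}) :
    (forall v, f (f v) = f v) -> (forall v, f v \in ideal_smul r) ->
  forall v, f v = 0.
Proof.
move=> ff fr v; have [n [t tgen]] := finite_generators fgV.
have [i|N Nr fN] := @end_matrix _ _ _ t f (fun x => forall i, x 0 i \in r).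
  exact: ideal_smul_comb.
have [|U [_ UN]] := residue1_unitmx complR kerE (M := 1%:M - N).
  rewrite map_mxB map_mx1 [X in _ - X](_ : _ = 0) ?subr0 //.
  apply/matrixP=> i j; rewrite [RHS]mxE mxE; apply/eqP; rewrite kerE.
  by have := Nr i j; rewrite mxE.
have [x ->] := tgen v.
rewrite -[x]mulmx1 -UN mulmxA mulmxBr mulmx1 linearB /= -fN linearB /= ff.
exact: subrr.
Qed.

Lemma free_fixed (f : {linear V -> V}) : (forall v, f (f v) = f v) ->
  is_free (predT : {pred V}) -> is_free (fixed f).
Proof.
move=> ff /(free_finite_basis fgV)[m [t [tgen tfree]]].
have [i|E _ fE] := @end_matrix _ _ _ t f (fun _ => True).
  by have [x ->] := tgen (f (t i)); exists x.
have tinj x y : comb t x = comb t y -> x = y.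
  by move=> txy; apply/subr0_eq/tfree; rewrite linearB /= txy subrr.
have EE : E *m E = E.
  apply/row_matrixP => i; apply: tinj.
  by rewrite -[in RHS](mul1mx E) !row_mul -!fE -[in LHS](mul1mx E) !row_mul -!fE ff.
have [k [T [TE [Y EY] Tfree]]] := idempotent_mx_basis complR kerE resK EE.
pose B : {pred V} := mem (codom (fun i => comb t (row i T))).
exists B; split.
  apply: lin_indep_codom => x; rewrite -comb_mulmx => /tfree; exact: Tfree.
move=> v; apply/fixedP/idP => [fv|].
  have [x vx] := tgen v.
  have xE : x = x *m E by apply: tinj; rewrite -fE -vx.
  by rewrite vx xE EY mulmxA comb_mulmx; exact: comb_lspan.
move=> vT; apply/fixedP; apply: lspan_min vT => _ /codomP[i ->].
by apply/fixedP; rewrite fE -row_mul TE.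
Qed.

End Complete.

(** * Spectral projections *)

(** The sum runs over the roots [s] of the reduced characteristic polynomial,
    which depends on the choice of generators and may have roots that are not
    eigenvalues of the reduction of [A].  The [e a] are set to 0 outside [s],
    so that idempotency and orthogonality hold for all scalars. *)
Lemma spectral_idempotents (C : closedFieldType) (R : comAlgType C) (r : idealr R)
    (res : {rmorphism R -> C}) (complR : adic_complete r)
    (kerE : forall x, (res x == 0) = (x \in r)) (resK : forall c, res c%:A = c)
    (V : lmodType R) (fgV : fin_gen (predT : {pred V})) (A : {linear V -> V}) :
  exists (s : seq C) (m : C -> nat) (e : C -> {poly R}),
    [/\ uniq s /\ forall a, a \notin s -> e a = 0,
        forall a v, poly_act A (e a) (poly_act A (e a) v) = poly_act A (e a) v,
        forall a b v, a != b -> poly_act A (e a) (poly_act A (e b) v) = 0,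
        forall v, v = \sum_(a <- s) poly_act A (e a) v
      & forall a v, poly_act A (('X - a%:A%:P) ^+ m a * e a) v
                      \in ideal_smul r].
Proof.
have [n [t tgen]] := finite_generators fgV.
have [i|M _ AM] := @end_matrix _ _ _ t A (fun _ => True).
  by have [x ->] := tgen (A (t i)); exists x.
pose J := poly_filt r M.
have filtJ : complete_filtration J by exact: poly_filt_complete.
have J0 p : (forall k, J k p) -> forall v, poly_act A p v = 0.
  move=> /(poly_filt_separated complR) p0 v; have [x ->] := tgen v.
  by rewrite (poly_act_comb AM) p0 mulmx0 linear0.
have J1 p : J 1%N p -> forall v, poly_act A p v \in ideal_smul r.
  move=> [q qr pq] v.
  have -> : poly_act A p v = poly_act A q v.
    by have [x ->] := tgen v; rewrite !(poly_act_comb AM) pq.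
  apply: rpred_sum => i _; apply: mem_lspan; apply/asboolP.
  by exists q`_i; [rewrite -ideal_pow1 | exists (iter i A v)].
have Jres p : char_poly (map_mx res M) %| map_poly res p -> J 1%N p.
  exact: poly_filt1_of_residue.
have [s [m [h [us hh hO h1 hX]]]] := crt_idempotents (char_poly_monic (map_mx res M)).
pose H a := map_poly (in_alg R) (h a).
have resH a : map_poly res (H a) = h a.
  by rewrite -map_poly_comp map_poly_id // => c _; exact: resK.
have [e [eH ee eO e1]] : exists e : C -> {poly R},
    [/\ {in s, forall a, J 1%N (e a - H a)},
        {in s, forall a k, J k (e a * e a - e a)},
        {in s &, forall a b, a != b -> forall k, J k (e a * e b)}
      & forall k, J k (\sum_(a <- s) e a - 1)].
  apply: lift_idempotents => // [a _|a b _ _ ab|]; apply: Jres.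
  - by rewrite rmorphB rmorphM /= resH.
  - by rewrite rmorphM /= !resH; exact: hO.
  - by rewrite rmorphB rmorph_sum rmorph1 /= (eq_bigr h).
pose e' a := if a \in s then e a else 0.
exists s, m, e'; split=> [|a v|a b v ab|v|a v].
- by split=> // a /negPf sa; rewrite /e' sa.
- rewrite /e'; case: ifP => sa; last by rewrite !poly_act0.
  rewrite -poly_actM -[e a in RHS]add0r -(subrK (e a) (e a * e a)) poly_actD.
  by rewrite (J0 _ (ee _ sa)) add0r add0r.
- rewrite /e' -poly_actM; case: ifP => sa; last by rewrite mul0r poly_act0.
  by case: ifP => sb; [exact/J0/eO | rewrite mulr0 poly_act0].
- rewrite -poly_act_sum (eq_big_seq e) => [|a sa]; last by rewrite /e' sa.
  rewrite -(subrK 1 (\sum_(a <- s) e a)) poly_actD (J0 _ e1) add0r.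
  by rewrite poly_act1.
rewrite /e'; case: ifP => sa; last by rewrite mulr0 poly_act0 rpred0.
apply: J1; set X := _ ^+ _; rewrite -(subrK (X * H a) (X * e a)) -mulrBr.
apply: (filtD filtJ); first by apply: (filtMl filtJ); exact: eH.
apply: Jres; rewrite rmorphM rmorphXn rmorphB /= map_polyX map_polyC /= resK resH.
exact: hX.
Qed.

Theorem corollary8p13 (C : closedFieldType) (charC : [pchar C] =i pred0)
    (R : comAlgType C) (r : idealr R)
    (locR : local_ring r) (noethR : noetherian R)
    (complR : adic_complete r) (resR : residue_field_is r)
    (V : lmodType R) (fgV : fin_gen (predT : {pred V}))
    (A : {linear V -> V}) :
  let Abar : {linear reduction r V -> reduction r V} := red_end r A in
  exists W : {rho : C | rho \in spectrum Abar} -> submodClosed V,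
    [/\ direct_sum W,
        forall rho v, v \in W rho -> A v \in W rho,
        forall rho (x : reduction r V),
          (exists2 v : V, v \in W rho & red r v = x) <->
          x \in gen_eigenspace Abar (val rho)
      & is_free (predT : {pred V}) -> forall rho, is_free (W rho)].
Proof.
move=> Abar; have [res [kerE resK]] := residue_morphism resR.
have [s [m [e [[us e0] ee eO e1 eX]]]] := spectral_idempotents complR kerE resK fgV A.
pose E a : {linear V -> V} := poly_act A (e a).
have rV_act p v : v \in ideal_smul r -> poly_act A p v \in ideal_smul r.
  exact: ideal_smul_stable.
have actC p q v : poly_act A p (poly_act A q v) = poly_act A q (poly_act A p v).
  by rewrite -!poly_actM mulrC.
have E_gen a v : red r (E a v) \in gen_eigenspace Abar a.
  apply/asboolP; exists (m a); rewrite iter_red_end -poly_actM.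
  exact/red_eq0/eX.
have E_spec a v : a \notin spectrum Abar -> E a v = 0.
  move=> na; apply: (idempotent_in_ideal_smul complR kerE fgV (ee a)) => {}v.
  exact/red_eq0/(gen_eigenspace_not_spectrum na)/E_gen.
(* Powers of 'X - a and 'X - b generate the unit ideal of C[X], and the
   component E b v is killed, modulo rV, by a power of each. *)
have gen_E a b v : a != b -> red r v \in gen_eigenspace Abar a ->
    E b v \in ideal_smul r.
  move=> ab /asboolP[N]; rewrite iter_red_end => /red_eq0 vN.
  have : coprimep (('X - a%:P) ^+ N) (('X - b%:P) ^+ m b).
    by apply/coprimep_expl/coprimep_expr; rewrite coprimep_XsubC root_XsubC eq_sym.
  case/Bezout_eq1_coprimepP=> u /(congr1 (map_poly (in_alg R))).
  rewrite rmorphD !rmorphM !rmorphXn !rmorphB rmorph1 /= !map_polyX !map_polyC /= => u1.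
  rewrite -[E b v]scale1r -(poly_actC A) polyC1 -u1 poly_actD !poly_actM.
  apply: rpredD; first by apply/rV_act; rewrite actC; exact: rV_act.
  by apply/rV_act; rewrite -poly_actM; exact: eX.
pose W (rho : {rho : C | rho \in spectrum Abar}) : submodClosed V :=
  fixed (E (val rho)).
exists W; split.
- split=> [v|s0 w us0 wW w0 j sj].
    exists (pmap insub s), (fun rho => E (val rho) v); split.
    + exact: pmap_sub_uniq.
    + by move=> rho; apply/fixedP; exact: ee.
    rewrite {1}[v]e1 -(big_map val xpredT (fun a => E a v)) /=.
    rewrite (pmap_filter (insubK _)) big_filter [RHS]big_mkcond; apply: eq_bigr => a _.
    by rewrite isSome_insub; case: ifPn => // /E_spec->.
  have wE i : E (val i) (w i) = w i by exact/fixedP.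
  have := congr1 (E (val j)) w0; rewrite linear0 linear_sum (bigD1_seq j) //= wE.
  by rewrite big1 ?addr0 // => i ij; rewrite -wE; apply: eO; rewrite (inj_eq val_inj) eq_sym.
- move=> rho v /fixedP vE; apply/fixedP; rewrite -[in RHS]vE.
  have AE w : A w = poly_act A 'X w.
    by rewrite -['X]mul1r poly_actMX poly_act1.
  by rewrite !AE actC.
- move=> rho x; split=> [[v /fixedP <- <-] // | xG].
  rewrite -[x]red_repr; set v := repr _; exists (E (val rho) v).
    by apply/fixedP; exact: ee.
  have vG : red r v \in gen_eigenspace Abar (val rho) by rewrite red_repr.
  apply/esym/red_eq; rewrite {1}[v]e1.
  have sumE : \sum_(a <- s | a != val rho) E a v \in ideal_smul r.
    by apply: rpred_sum => a ar; apply: gen_E vG; rewrite eq_sym.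
  have [sr|sr] := boolP (val rho \in s).
    by rewrite (bigD1_seq (val rho)) //= addrAC subrr add0r.
  (* Now E (val rho) is 0, and every component of v reduces to 0. *)
  have -> : E (val rho) v = 0 by rewrite /E /= e0 ?poly_act0.
  rewrite subr0 big_seq; apply: rpred_sum => a sa.
  by apply: gen_E vG; apply: contraNneq sr => ->.
by move=> frV rho; exact: (free_fixed complR kerE resK fgV (ee _) frV).
Qed.
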